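(* Let $\varrho$ be a normalized proximate order of order $\rho>0$, let $\sigma\ge0$, and let $f(x)=\sum_{\ell=0}^\infty x^\ell a_\ell\in\mathcal{SM}_L(\mathbb{R}^{n+1})$ ($a_\ell\in\mathbb{R}_n$). Then the following are equivalent: (1) $f\in A_{\varrho,\sigma+0}$; (2) $\limsup_{r\to\infty}\frac{\sup_{|x|\le r}\ln|f(x)|}{r^{\varrho(r)}}\le\sigma$; (3) $\limsup_{\ell\to\infty}|a_\ell|^{1/\ell}\varphi(\ell)\le(e\rho\sigma)^{1/\rho}$; (4) $\inf\{\beta>0: f\in A_{\varrho,\beta}\}\le\sigma$.
   Context: $\mathbb{R}_n$ is the real Clifford algebra generated by $e_1,\dots,e_n$ with $e_ie_j=-e_je_i$ ($i\ne j$), $e_i^2=-1$, with Euclidean norm $|a|^2=\sum_Aa_A^2$ for $a=\sum_Aa_Ae_A$. Paravectors $x=x_0+\sum x_\ell e_\ell$ are identified with $\mathbb{R}^{n+1}$; $\mathbb{S}=\{\sum x_\ell e_\ell:\sum x_\ell^2=1\}$. $\mathcal{SM}_L(\mathbb{R}^{n+1})$ is the set of entire left slice monogenic functions: $f(u+jv)=f_0(u,v)+jf_1(u,v)$ for all $u,v\in\mathbb{R}$, $j\in\mathbb{S}$, with $f_0,f_1:\mathbb{R}^2\to\mathbb{R}_n$ continuously differentiable, $f_0$ even and $f_1$ odd in $v$, and $\partial_uf_0=\partial_vf_1$, $\partial_vf_0=-\partial_uf_1$. Every such $f$ equals its everywhere convergent series $\sum x^\ell a_\ell$ with $a_\ell=\partial_{x_0}^\ell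 f(0)/\ell!$. A proximate order is a differentiable $\varrho:[0,\infty)\to[0,\infty)$ with $\lim_{r\to\infty}\varrho(r)=\rho>0$ and $\lim_{r\to\infty}\varrho'(r)r\ln r=0$; normalized means $r\mapsto r^{\varrho(r)}$ is strictly increasing on $(0,\infty)$ and tends to $0$ as $r\to0^+$; $\varphi:(0,\infty)\to(0,\infty)$ is the inverse of $r\mapsto r^{\varrho(r)}$. For $\sigma>0$: $A_{\varrho,\sigma}=\{f\in\mathcal{SM}_L(\mathbb{R}^{n+1}):\sup_x|f(x)|e^{-\sigma|x|^{\varrho(|x|)}}<\infty\}$; for $\sigma\ge0$: $A_{\varrho,\sigma+0}=\bigcap_{\epsilon>0}A_{\varrho,\sigma+\epsilon}$. *)

(* Defs.v *)
From HB Require Import structures.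
From mathcomp Require Import all_boot all_order all_algebra.
From mathcomp Require Import all_classical all_reals all_analysis.
Set Implicit Arguments. Unset Strict Implicit. Unset Printing Implicit Defensive.
Import Order.TTheory GRing.Theory Num.Theory.
Import numFieldNormedType.Exports.
Local Open Scope ring_scope.

Section Clifford.
Variables (R : realType) (n : nat).

(* The real Clifford algebra R_n: an element a = sum_A a_A e_A is the
   family of its real coordinates indexed by subsets A of {1..n}
   (here 'I_n = {0..n-1}; e_A = e_{a1}...e_{ak} with a1 < ... < ak). *)
Definition Cl := {set 'I_n} -> R.

Definition clzero : Cl := fun _ => 0.
Definition clone : Cl := fun A => if A == finset.set0 then 1 else 0.
Definition cladd (a b : Cl) : Cl := fun A => a A + b A.
Definition clscale (t : R) (a : Cl) : Cl := fun A => t * a A.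
Definition clbasis (A : {set 'I_n}) : Cl := fun B => if B == A then 1 else 0.

(* sign of e_A e_B = (-1)^(#{(i,j) in A x B | j < i} + #|A :&: B|) e_{A \triangle B} *)
Definition clsign (A B : {set 'I_n}) : R :=
  (-1) ^+ (#|[set p : 'I_n * 'I_n | (p.1 \in A) && (p.2 \in B) && (p.2 < p.1)%N]|
           + #|A :&: B|).

Definition clmul (a b : Cl) : Cl := fun C =>
  \sum_(A : {set 'I_n}) \sum_(B : {set 'I_n} | (A :\: B) :|: (B :\: A) == C)
     clsign A B * a A * b B.

Definition clpow (a : Cl) (l : nat) : Cl := iter l (clmul a) clone.

Definition clnorm (a : Cl) : R := Num.sqrt (\sum_(A : {set 'I_n}) a A ^+ 2).

(* Paravectors x = x0 + sum_l x_l e_l, identified with R^{n+1} *)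
Definition Para := (R * ('I_n -> R))%type.
Definition pv (x : Para) : Cl := fun A =>
  if A == finset.set0 then x.1 else
  \sum_(i : 'I_n) (if A == [set i] then x.2 i else 0).
Definition pnorm (x : Para) : R := clnorm (pv x).

(* w represents the imaginary unit j = sum_l w_l e_l in S *)
Definition in_sphere (w : 'I_n -> R) : Prop := \sum_(i : 'I_n) w i ^+ 2 = 1.

Definition pdu (g : R -> R -> R) (u v : R) : R := derive1 (fun t => g t v) u.
Definition pdv (g : R -> R -> R) (u v : R) : R := derive1 (fun t => g u t) v.

Definition C1 (g : R -> R -> R) : Prop :=
  continuous (fun p : R * R => g p.1 p.2) /\
  (forall u v, derivable (fun t => g t v) u 1 /\ derivable (fun t => g u t) v 1) /\
  continuous (fun p : R * R => pdu g p.1 p.2) /\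
  continuous (fun p : R * R => pdv g p.1 p.2).

Definition slice_monogenic (f : Para -> Cl) : Prop :=
  exists f0 f1 : R -> R -> Cl,
    (forall A, C1 (fun u v => f0 u v A)) /\ (forall A, C1 (fun u v => f1 u v A)) /\
    (forall u v, f0 u (- v) = f0 u v) /\
    (forall u v, f1 u (- v) = clscale (-1) (f1 u v)) /\
    (forall A u v, pdu (fun s t => f0 s t A) u v = pdv (fun s t => f1 s t A) u v) /\
    (forall A u v, pdv (fun s t => f0 s t A) u v = - pdu (fun s t => f1 s t A) u v) /\
    (forall (u v : R) (w : 'I_n -> R), in_sphere w ->
        f (u, fun i => v * w i) = cladd (f0 u v) (clmul (pv (0, w)) (f1 u v))).

Local Open Scope classical_set_scope.
(* f(x) = sum_l x^l a_l, the series converging (coordinatewise, equivalently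
   in norm) at every paravector x *)
Definition has_series (f : Para -> Cl) (a : nat -> Cl) : Prop :=
  forall (x : Para) (A : {set 'I_n}),
    (fun N : nat => \sum_(0 <= l < N) clmul (clpow (pv x) l) (a l) A)
      @ \oo --> f x A.

End Clifford.
Local Open Scope classical_set_scope.

Definition proximate_order (R : realType) (rho : R -> R) (rho0 : R) : Prop :=
  (forall r, 0 <= r -> 0 <= rho r) /\
  (forall r, 0 < r -> derivable rho r 1) /\
  cvg ((fun h : R => (rho h - rho 0) / h) @ 0^'+) /\
  0 < rho0 /\
  rho r @[r --> +oo] --> rho0 /\
  (derive1 rho r * r * ln r) @[r --> +oo] --> 0.

Definition normalized (R : realType) (rho : R -> R) : Prop :=
  {in `]0, +oo[ &, {mono (fun r => r `^ rho r) : r s / r < s}}%R /\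
  (fun r => r `^ rho r) @ 0^'+ --> 0.

Definition A_class (R : realType) (n : nat) (rho : R -> R) (sigma : R)
    (f : Para R n -> Cl R n) : Prop :=
  slice_monogenic f /\
  exists M : R, forall x : Para R n,
    clnorm (f x) * expR (- sigma * (pnorm x `^ rho (pnorm x))) <= M.

Definition A_class0 (R : realType) (n : nat) (rho : R -> R) (sigma : R)
    (f : Para R n -> Cl R n) : Prop :=
  forall eps : R, 0 < eps -> A_class rho (sigma + eps) f.

Definition eln (R : realType) (t : R) : \bar R :=
  if 0 < t then (ln t)%:E else -oo%E.

Definition logmax (R : realType) (n : nat) (f : Para R n -> Cl R n) (r : R) : \bar R :=
  ereal_sup [set eln (clnorm (f x)) | x in [set x : Para R n | pnorm x <= r]].

(* Main.v *)
(* Growth side: [d/d(ln r) (rho(r) ln r) -> rho0], so by the mean value theorem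
   [ln (phi s) - ln (phi l) = p (ln s - ln l)] with [p] close to [1/rho0]. With
   [ln y <= y - 1] this bounds every term [|a_l| r^l] by
   [exp ((sigma + eps) r^rho(r))] times a geometric factor; conversely the Cauchy
   estimate at [r = phi (l / (sigma rho0))] bounds [|a_l|].
   Clifford side: on the slice spanned by [1] and the first unit, left
   multiplication acts on each pair of coordinates [(A, A xor {first unit})] as a
   complex multiplication, so there [f] is a family of complex power series, whose
   coefficients are recovered by averaging over roots of unity. The decomposition
   [f0 + j f1] carries bounds on this slice over to all paravectors, so neither
   associativity of the product nor multiplicativity of the norm is needed. *)
Require Import Defs.
From HB Require Import structures.
From mathcomp Require Import all_boot all_order all_algebra.
From mathcomp Require Import all_classical all_reals all_analysis.
From mathcomp Require Import ring lra.
Import Order.TTheory GRing.Theory Num.Theory.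
Import numFieldNormedType.Exports.
Local Open Scope ring_scope.

(** * Clifford coordinates on a slice *)

Section CliffordNorm.
Variables (R : realType) (n : nat).
Implicit Types (a b : Cl R n) (A B C : {set 'I_n}).

Lemma coord_le_clnorm a A : `|a A| <= clnorm a.
Proof.
rewrite -sqrtr_sqr ler_wsqrtr // (bigD1 A) //= lerDl.
by apply: sumr_ge0 => B _; exact: sqr_ge0.
Qed.

(** The square root of the number of coordinates is weakened to that number, since constant factors
    do not affect the growth classes. *)
Lemma clnorm_le a (B : R) : 0 <= B -> (forall A, `|a A| <= B) ->
  clnorm a <= #|{set 'I_n}|%:R * B.
Proof.
move=> B0 aB; apply: (@le_trans _ _ (Num.sqrt ((#|{set 'I_n}|%:R * B) ^+ 2))).
  apply: ler_wsqrtr; rewrite exprMn.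
  apply: (@le_trans _ _ (\sum_(A : {set 'I_n}) B ^+ 2)).
    apply: ler_sum => A _.
    by rewrite -real_normK ?num_real // lerXn2r ?nnegrE.
  rewrite sumr_const -[leLHS]mulr_natl ler_wpM2r ?sqr_ge0 //.
  rewrite -natrX ler_nat expnS expn1 leq_pmulr //.
  by apply/card_gt0P; exists finset.set0.
by rewrite sqrtr_sqr ger0_norm // mulr_ge0.
Qed.

(** The empty set and the singletons are distinct indices, so each inner sum of [pv] has at most one
    nonzero term and squaring passes through it. *)
Lemma pnorm_sqr (x : Para R n) :
  pnorm x ^+ 2 = x.1 ^+ 2 + \sum_(i : 'I_n) x.2 i ^+ 2.
Proof.
rewrite sqr_sqrtr; last by apply: sumr_ge0 => A _; exact: sqr_ge0.
rewrite (bigD1 finset.set0) //= {1}/pv eqxx; congr (_ + _).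
rewrite (eq_bigr (fun A => \sum_(i : 'I_n) (if A == [set i] then x.2 i ^+ 2 else 0))).
  rewrite exchange_big /=; apply: eq_bigr => i _.
  rewrite -big_mkcondr (big_pred1 [set i]) // => A /=.
  rewrite andbC; case: eqVneq => //= ->.
  by apply/finset.set0Pn; exists i; rewrite set11.
move=> A A0; rewrite /pv (negPf A0).
have [/existsP[i /eqP ->]|/existsPn H] := boolP [exists i, A == [set i]].
  rewrite (bigD1 i) //= eqxx big1 ?addr0; last first.
    by move=> j ji; rewrite (inj_eq set1_inj) eq_sym (negPf ji).
  rewrite (bigD1 i) //= eqxx big1 ?addr0 //.
  by move=> j ji; rewrite (inj_eq set1_inj) eq_sym (negPf ji).
by rewrite !big1 ?expr0n // => i _; rewrite (negPf (H i)).
Qed.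

Lemma pnorm_ge0 (x : Para R n) : 0 <= pnorm x.
Proof. exact: sqrtr_ge0. Qed.

(** Symmetric difference is a group law, so [A] and [C] determine [B]. *)
Lemma clmulE a b C : clmul a b C =
  \sum_A clsign R A ((A :\: C) :|: (C :\: A)) * a A
         * b ((A :\: C) :|: (C :\: A)).
Proof.
apply: eq_bigr => A _; rewrite (big_pred1 ((A :\: C) :|: (C :\: A))) // => B /=.
by apply/eqP/eqP => [<-|->]; apply/finset.setP => i; rewrite !inE; do !case: (i \in _).
Qed.

Lemma coord_clmul_le a b C (x y : R) : (forall A, `|a A| <= x) ->
  (forall A, `|b A| <= y) -> `|clmul a b C| <= #|{set 'I_n}|%:R * (x * y).
Proof.
move=> ax bY; rewrite clmulE; apply: (le_trans (ler_norm_sum _ _ _)).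
rewrite mulr_natl -sumr_const; apply: ler_sum => A _.
by rewrite !normrM normrX normrN1 expr1n mul1r ler_pM.
Qed.
End CliffordNorm.

(** * The complex plane spanned by 1 and the first unit *)

Section Slice.
Variables (R : realType) (n : nat) (hn : (0 < n)%N).
Implicit Types (b : Cl R n) (A B C : {set 'I_n}).

Let i0 : 'I_n := Ordinal hn.

Definition first_unit (i : 'I_n) : R := (i == i0)%:R.
Definition slice (u v : R) : Para R n := (u, fun i => v * first_unit i).
Definition planar (p q : R) : Cl R n := fun A =>
  if A == finset.set0 then p else if A == [set i0] then q else 0.

(** The permutation of basis indices that multiplication by the first unit induces, up to sign. *)
Definition flip A := ([set i0] :\: A) :|: (A :\: [set i0]).

Lemma flipK : involutive flip.
Proof. by move=> A; apply/finset.setP => i; rewrite !inE; case: (i == i0); case: (i \in A). Qed.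

Lemma mem_flip A : (i0 \in flip A) = (i0 \notin A).
Proof. by rewrite !inE eqxx; case: (i0 \in A). Qed.

Lemma first_unit_sphere : in_sphere first_unit.
Proof.
rewrite /in_sphere (bigD1 i0) //= /first_unit eqxx expr1n big1 ?addr0 //.
by move=> i /negPf ->; rewrite expr0n.
Qed.

Lemma pv_slice u v : pv (slice u v) = planar u v.
Proof.
apply/funext => A; rewrite /pv /planar /slice /first_unit /=; case: ifP => // _.
rewrite (bigD1 i0) // big1 => [|i /andP[_ /negPf ->]].
  by rewrite eqxx mulr1 /= addr0.
by rewrite mulr0 if_same.
Qed.

Lemma clsign_set0 B : clsign R finset.set0 B = 1.
Proof.
rewrite /clsign finset.set0I cards0 addn0.
rewrite (_ : [set p | _] = finset.set0) ?cards0 //.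
by apply/finset.setP => p; rewrite !inE.
Qed.

(** The first unit has the least index, so no transposition is counted; the only sign comes from its
    square being -1. *)
Lemma clsign_first B : clsign R [set i0] B = (-1) ^+ (i0 \in B).
Proof.
rewrite /clsign (_ : [set p | _] = finset.set0) ?cards0 ?add0n.
  congr (_ ^+ _); case: (boolP (i0 \in B)) => h.
    by rewrite (finset.setIidPl _) ?cards1 // finset.sub1set.
  by apply/eqP; rewrite cards_eq0 finset.setI_eq0 disjoints1.
apply/finset.setP => p; rewrite !inE; case: eqVneq => //= ->.
by rewrite ltn0 andbF.
Qed.

(** Only the empty set and the first singleton contribute. The signs at [C] and [flip C] are
    opposite, so on this pair of coordinates the product is complex multiplication by p + iq, the
    real part sitting at the index without the first unit. *)
Lemma clmul_planar p q b C :
  clmul (planar p q) b C = p * b C + q * ((-1) ^+ (i0 \notin C) * b (flip C)).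
Proof.
have i00 : [set i0] != finset.set0 by apply/finset.set0Pn; exists i0; rewrite set11.
rewrite clmulE (bigD1 finset.set0) //= (bigD1 [set i0]) //= big1 ?addr0.
  rewrite -/(flip C) clsign_first mem_flip /planar eqxx (negPf i00) eqxx.
  by rewrite finset.set0D finset.setD0 finset.set0U clsign_set0; ring.
by move=> A /andP[h0 h1]; rewrite /planar (negPf h0) (negPf h1) mulr0 mul0r.
Qed.

Lemma clmul_planar_planar p q p' q' :
  clmul (planar p q) (planar p' q') = planar (p * p' - q * q') (p * q' + q * p').
Proof.
have i00 : [set i0] != finset.set0 by apply/finset.set0Pn; exists i0; rewrite set11.
have flip0 : flip finset.set0 = [set i0] by rewrite /flip finset.setD0 finset.set0D finset.setU0.
have flip1 : flip [set i0] = finset.set0 by rewrite -flip0 flipK.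
apply/funext => C; rewrite clmul_planar /planar.
have [->|C0] := eqVneq C finset.set0.
  by rewrite flip0 (negPf i00) eqxx !inE; ring.
have [->|C1] := eqVneq C [set i0].
  by rewrite flip1 eqxx !inE eqxx; ring.
have -> : (flip C == finset.set0) = false.
  by rewrite -flip1 (inj_eq (inv_inj flipK)) (negPf C1).
have -> : (flip C == [set i0]) = false.
  by rewrite -flip0 (inj_eq (inv_inj flipK)) (negPf C0).
ring.
Qed.

(** The two-square identity keeps the modulus multiplicative along the induction. *)
Lemma clpow_planar u v l : exists p q : R,
  clpow (planar u v) l = planar p q /\ p ^+ 2 + q ^+ 2 = (u ^+ 2 + v ^+ 2) ^+ l.
Proof.
elim: l => [|l [p [q [E H]]]].
  exists 1, 0; split; last by ring.
  by apply/funext => A; rewrite /= /clone /planar if_same.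
exists (u * p - v * q), (u * q + v * p); split.
  by rewrite /clpow iterS -/(clpow _ l) E clmul_planar_planar.
by rewrite (exprS _ l) -H; ring.
Qed.

(** De Moivre's formula, by the addition theorems. *)
Lemma clpow_polar r t l :
  clpow (planar (r * cos t) (r * sin t)) l =
  planar (r ^+ l * cos (l%:R * t)) (r ^+ l * sin (l%:R * t)).
Proof.
elim: l => [|l IH].
  rewrite mul0r cos0 sin0 mulr0 mulr1.
  by apply/funext => A; rewrite /= /clone /planar if_same.
rewrite /clpow iterS -/(clpow _ l) IH clmul_planar_planar.
rewrite -natr1 mulrDl mul1r cosD sinD exprS.
by congr planar; ring.
Qed.

Lemma pnorm_slice_sqr u v : pnorm (slice u v) ^+ 2 = u ^+ 2 + v ^+ 2.
Proof.
rewrite pnorm_sqr /=; congr (_ + _).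
have := first_unit_sphere; rewrite /in_sphere => E.
rewrite -[RHS]mulr1 -E mulr_sumr; apply: eq_bigr => i _.
by rewrite exprMn.
Qed.

(** Both planar components of the power are at most its modulus; the 2 counts the two terms of
    [clmul_planar]. *)
Lemma coord_clpow_slice_le u v l b C :
  `|clmul (clpow (pv (slice u v)) l) b C| <= 2 * (clnorm b * pnorm (slice u v) ^+ l).
Proof.
rewrite pv_slice; have [p [q [-> H]]] := clpow_planar u v l.
have T0 : 0 <= pnorm (slice u v) ^+ l by rewrite exprn_ge0 // pnorm_ge0.
move: H; rewrite -(pnorm_slice_sqr u v) exprAC => H.
have pT : `|p| <= pnorm (slice u v) ^+ l.
  rewrite -(ler_pXn2r (n := 2)) ?nnegrE // real_normK ?num_real //.
  by rewrite -H lerDl sqr_ge0.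
have qT : `|q| <= pnorm (slice u v) ^+ l.
  rewrite -(ler_pXn2r (n := 2)) ?nnegrE // real_normK ?num_real //.
  by rewrite -H lerDr sqr_ge0.
rewrite clmul_planar mulrDl mul1r; apply: (le_trans (ler_normD _ _)).
rewrite !normrM normrX normrN1 expr1n mul1r [clnorm b * _]mulrC.
by apply: lerD; apply: ler_pM => //; exact: coord_le_clnorm.
Qed.

(* On the slice through the first unit, [f0] is the mean of [f] at conjugate
   points and multiplying [f1] by the unit only permutes coordinates up to sign. *)
Lemma slice_monogenic_coord_le (f : Para R n -> Cl R n) (t B : R) :
  slice_monogenic f -> 0 <= t ->
  (forall u v A, pnorm (slice u v) = t -> `|f (slice u v) A| <= B) ->
  forall x A, pnorm x = t -> `|f x A| <= (1 + #|{set 'I_n}|%:R) * B.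
Proof.
move=> [f0 [f1 [_ [_ [ev [od [_ [_ fE]]]]]]]] t0 fB x A xt.
have ge1 : 1 <= 1 + #|{set 'I_n}|%:R :> R by rewrite lerDl.
pose v := Num.sqrt (\sum_i x.2 i ^+ 2).
have s0 : 0 <= \sum_i x.2 i ^+ 2 by apply: sumr_ge0 => i _; exact: sqr_ge0.
have v2 : v ^+ 2 = \sum_i x.2 i ^+ 2 by rewrite sqr_sqrtr.
have tv w : w ^+ 2 = v ^+ 2 -> pnorm (slice x.1 w) = t.
  move=> wv; apply/eqP; rewrite -(eqrXn2 (n := 2)) ?pnorm_ge0 //.
  by rewrite pnorm_slice_sqr wv -xt pnorm_sqr v2.
have B0 : 0 <= B by apply: le_trans (fB _ _ A (tv v erefl)).
(* A real [x] has no direction to normalise, but it already lies on the slice. *)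
have [v0|v0] := eqVneq v 0.
  have x2 : x.2 = fun i => 0 * first_unit i.
    apply/funext => i; rewrite mul0r; apply/eqP; rewrite -sqrf_eq0.
    move: v2; rewrite v0 expr0n /= => /esym /eqP.
    rewrite psumr_eq0; last by move=> j _; exact: sqr_ge0.
    by move=> /allP /(_ i); rewrite mem_index_enum => /(_ isT).
  have -> : x = slice x.1 0 by rewrite /slice -x2; case: (x).
  apply: le_trans (fB _ _ A (tv _ _)) _; first by rewrite v0.
  by rewrite ler_peMl.
have fplus C : f (slice x.1 v) C = f0 x.1 v C
    + (-1) ^+ (i0 \notin C) * f1 x.1 v (flip C).
  rewrite fE; last exact: first_unit_sphere.
  rewrite /cladd (_ : pv (0, first_unit) = planar 0 1); last first.
    rewrite -pv_slice; congr (pv (_, _)).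
    by apply/funext => i; rewrite mul1r.
  by rewrite clmul_planar mul0r add0r mul1r.
have fminus C : f (slice x.1 (- v)) C = f0 x.1 v C
    - (-1) ^+ (i0 \notin C) * f1 x.1 v (flip C).
  rewrite fE; last exact: first_unit_sphere.
  rewrite /cladd (_ : pv (0, first_unit) = planar 0 1); last first.
    rewrite -pv_slice; congr (pv (_, _)).
    by apply/funext => i; rewrite mul1r.
  rewrite clmul_planar ev od /clscale; ring.
have f0B C : `|f0 x.1 v C| <= B.
  have := fB _ _ C (tv v erefl); have := fB _ _ C (tv (- v) (sqrrN _)).
  by rewrite fplus fminus !ler_norml; lra.
have f1B C : `|f1 x.1 v C| <= B.
  rewrite -(flipK C); move: (flip C) => {}C.
  have : `|(-1) ^+ (i0 \notin C) * f1 x.1 v (flip C)| <= B.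
    have := fB _ _ C (tv v erefl); have := fB _ _ C (tv (- v) (sqrrN _)).
    by rewrite fplus fminus !ler_norml; lra.
  by rewrite normrM normrX normrN1 expr1n mul1r.
(* [x] shares [f0] and [f1] with the slice points and differs from them only in this unit. *)
pose w i := x.2 i / v.
have ws : in_sphere w.
  rewrite /in_sphere /w (eq_bigr (fun i => x.2 i ^+ 2 / v ^+ 2)).
    by rewrite -mulr_suml -v2 divff // sqrf_eq0.
  by move=> i _; rewrite expr_div_n.
have -> : x = (x.1, fun i => v * w i).
  rewrite [LHS]surjective_pairing; congr pair; apply/funext => i.
  by rewrite /w mulrC divfK.
rewrite fE // mulrDl mul1r; apply: (le_trans (ler_normD _ _)).
apply: lerD => //; rewrite -[X in _ * X]mul1r.
apply: coord_clmul_le => // C.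
apply: (le_trans (coord_le_clnorm _ _ (pv (0, w)) C)).
rewrite -/(pnorm (0, w)) -(ler_pXn2r (n := 2)) ?nnegrE ?pnorm_ge0 //.
by rewrite pnorm_sqr /= expr0n add0r ws expr1n.
Qed.
End Slice.

(** * Cauchy estimate by averaging over roots of unity *)

Section TrigonometricCauchy.
Variable R : realType.
Local Open Scope classical_set_scope.

(** Shifting the index by one over a full period leaves the vector (C, S) unchanged, yet rotates it
    by [al]; a nontrivial rotation fixes only 0. *)
Lemma trig_sums_eq0 (al : R) (N : nat) :
  cos al != 1 -> cos (N%:R * al) = 1 -> sin (N%:R * al) = 0 ->
  \sum_(0 <= k < N) cos (k%:R * al) = 0 /\ \sum_(0 <= k < N) sin (k%:R * al) = 0.
Proof.
move=> al1 cN sN.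
have shift (F : nat -> R) : F N = F 0%N ->
    \sum_(0 <= k < N) F k.+1 = \sum_(0 <= k < N) F k.
  by move=> FN; apply: (addrI (F 0%N)); rewrite -big_nat_recl // big_nat_recr //= FN addrC.
set C := \sum_(0 <= k < N) cos _; set S := \sum_(0 <= k < N) sin _.
have HC : C = C * cos al - S * sin al.
  rewrite -[LHS](shift (fun k => cos (k%:R * al))) ?mul0r ?cos0 //.
  rewrite /C /S !mulr_suml -sumrB; apply: eq_bigr => k _.
  by rewrite -natr1 mulrDl mul1r cosD.
have HS : S = S * cos al + C * sin al.
  rewrite -[LHS](shift (fun k => sin (k%:R * al))) ?mul0r ?sin0 //.
  rewrite /C /S !mulr_suml -big_split; apply: eq_bigr => k _.
  by rewrite -natr1 mulrDl mul1r sinD.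
(* This is the determinant of the rotation minus the identity. *)
have c1 : 2 * (1 - cos al) != 0.
  by rewrite mulf_neq0 // subr_eq0 eq_sym.
have cs : sin al ^+ 2 = 1 - cos al ^+ 2 by rewrite -(cos2Dsin2 al) addrC addKr.
have E1 : C * (1 - cos al) = - S * sin al by rewrite mulrBr mulr1 {1}HC; ring.
have E2 : S * (1 - cos al) = C * sin al by rewrite mulrBr mulr1 {1}HS; ring.
split; apply: (mulIf c1); rewrite mul0r.
  have -> : C * (2 * (1 - cos al)) =
      C * (1 - cos al) * (1 - cos al) + C * (1 - cos al ^+ 2) by ring.
  rewrite -cs E1.
  have -> : - S * sin al * (1 - cos al) = - (S * (1 - cos al)) * sin al by ring.
  by rewrite E2; ring.
have -> : S * (2 * (1 - cos al)) =
    S * (1 - cos al) * (1 - cos al) + S * (1 - cos al ^+ 2) by ring.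
rewrite -cs E2.
have -> : C * sin al * (1 - cos al) = C * (1 - cos al) * sin al by ring.
by rewrite E1; ring.
Qed.

Lemma cos_natmul_2pi (m : nat) : cos (m%:R * (pi *+ 2)) = 1 :> R.
Proof. by have := periodicn (@cosD2pi R) m 0; rewrite add0r cos0 mulr_natl. Qed.

Lemma sin_natmul_2pi (m : nat) : sin (m%:R * (pi *+ 2)) = 0 :> R.
Proof. by have := periodicn (@sinD2pi R) m 0; rewrite add0r sin0 mulr_natl. Qed.

Lemma trig_orthogonality (N m l : nat) : (m < N)%N -> (l < N)%N ->
  \sum_(0 <= k < N) cos (k%:R * ((m%:R - l%:R) * (pi *+ 2 / N%:R))) =
    (if m == l then N%:R else 0) :> R /\
  \sum_(0 <= k < N) sin (k%:R * ((m%:R - l%:R) * (pi *+ 2 / N%:R))) = 0 :> R.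
Proof.
move=> mN lN; have N0 : (0 < N)%N by apply: leq_trans mN.
have N0' : 0 < N%:R :> R by rewrite ltr0n.
have [->|ml] := eqVneq m l.
  rewrite subrr mul0r; split.
    under eq_bigr do rewrite mulr0 cos0.
    by rewrite sumr_const_nat subn0.
  by rewrite big1 // => k _; rewrite mulr0 sin0.
apply: trig_sums_eq0.
(* The half angle [be] lies strictly between 0 and pi, so its sine is positive and the cosine of its
   double is not 1. Evenness of the cosine handles m < l. *)
- have ne1 (p q : nat) : (p < N)%N -> (q < p)%N ->
      cos ((p%:R - q%:R) * (pi *+ 2 / N%:R)) != 1 :> R.
    move=> pN qp; pose be : R := (p%:R - q%:R) * (pi / N%:R).
    have -> : (p%:R - q%:R) * (pi *+ 2 / N%:R) = be *+ 2.
      by rewrite /be -mulrnAr mulrnAl.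
    have d0 : 0 < p%:R - q%:R :> R by rewrite subr_gt0 ltr_nat.
    have dN : p%:R - q%:R < N%:R :> R.
      by apply: (@le_lt_trans _ _ p%:R); [rewrite gerBl | rewrite ltr_nat].
    have : 0 < sin be.
      apply: sin_gt0_pi; rewrite /be mulr_gt0 ?divr_gt0 ?pi_gt0 //=.
      rewrite mulrCA -[ltRHS]mulr1 ltr_pM2l ?pi_gt0 //.
      by rewrite ltr_pdivrMr // mul1r.
    move=> sb; rewrite cos_mulr2n; apply/eqP => E.
    have := cos2Dsin2 be; have : 0 < sin be ^+ 2 by rewrite exprn_gt0.
    by move: E; rewrite mulr2n; lra.
  have [lm|lm] := ltnP l m; first exact: ne1.
  by rewrite -cosN -mulNr opprB; apply: ne1; rewrite // ltn_neqAle ml.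
- have -> : N%:R * ((m%:R - l%:R) * (pi *+ 2 / N%:R)) =
     m%:R * (pi *+ 2) - l%:R * (pi *+ 2) :> R by field; rewrite gt_eqF.
  by rewrite cosB !cos_natmul_2pi !sin_natmul_2pi mulr0 addr0 mulr1.
- have -> : N%:R * ((m%:R - l%:R) * (pi *+ 2 / N%:R)) =
     m%:R * (pi *+ 2) - l%:R * (pi *+ 2) :> R by field; rewrite gt_eqF.
  by rewrite sinB !cos_natmul_2pi !sin_natmul_2pi mulr0 mul0r subr0.
Qed.

Lemma norm_cvg_le (u : nat -> R) (l B : R) :
  u @ \oo --> l -> (\forall k \near \oo, `|u k| <= B) -> `|l| <= B.
Proof.
move=> ul uB; have nl : (fun k => `|u k|) @ \oo --> `|l| by exact: cvg_norm.
by rewrite -(cvg_lim _ nl) //; apply: limr_le => //; apply/cvg_ex; exists `|l|.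
Qed.

Lemma half_pow_sum_le (N L : nat) :
  \sum_(N <= l < L) (2^-1 : R) ^+ l <= 2 * 2^-1 ^+ N.
Proof.
have [NL|LN] := leqP N L; last first.
  by rewrite big_geq ?(ltnW LN) // mulr_ge0 // exprn_ge0.
suff -> : \sum_(N <= l < L) (2^-1 : R) ^+ l = 2 * 2^-1 ^+ N - 2 * 2^-1 ^+ L.
  by rewrite gerBl mulr_ge0 // exprn_ge0.
(* Telescoping: each term is twice itself minus twice its successor. *)
rewrite -mulrBr -opprB -(telescope_sumr _ NL) -sumrN mulr_sumr.
by apply: eq_bigr => l _; rewrite exprS; field.
Qed.

Lemma series_tail_le (u : nat -> R) (l B : R) (N : nat) : 0 <= B ->
  (fun L : nat => \sum_(0 <= k < L) u k) @ \oo --> l ->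
  (forall k, `|u k| <= B * 2^-1 ^+ k) ->
  `|l - \sum_(0 <= k < N) u k| <= 2 * B * 2^-1 ^+ N.
Proof.
move=> B0 ul uB.
have H : (fun L : nat => \sum_(0 <= k < L) u k - \sum_(0 <= k < N) u k) @ \oo
    --> l - \sum_(0 <= k < N) u k by apply: cvgB => //; exact: cvg_cst.
apply: (norm_cvg_le _ _ _ H); near=> L.
have NL : (N <= L)%N by near: L; exact: nbhs_infty_ge.
rewrite (big_cat_nat _ NL) //= addrAC subrr add0r; apply: (le_trans (ler_norm_sum _ _ _)).
apply: (@le_trans _ _ (\sum_(N <= k < L) B * 2^-1 ^+ k)); first exact: ler_sum.
by rewrite -mulr_sumr [2 * B]mulrC -mulrA ler_wpM2l ?half_pow_sum_le.
Unshelve. all: by end_near.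
Qed.

Lemma eps_half_pow_le (x y B : R) (m : nat) : 0 <= B ->
  (forall N, (m < N)%N -> x <= y + B * 2^-1 ^+ N) -> x <= y.
Proof.
move=> B0 H; apply/ler_addgt0Pr => e e0.
have c0 : (fun N : nat => B * (2^-1 : R) ^+ N) @ \oo --> (0 : R).
  rewrite -[0](mulr0 B); apply: cvgM; first exact: cvg_cst.
  by apply: cvg_expr; rewrite ger0_norm // invf_lt1 // ltr1n.
have [N0 _ HN] := (cvgrPdist_lt _ _).1 c0 _ e0.
pose N := maxn N0 m.+1.
apply: le_trans (H N _) _; first by rewrite leq_max leqnn orbT.
have := HN N; rewrite /= leq_max leqnn => /(_ isT).
rewrite sub0r normrN lerD2l => /ltW; apply: le_trans; exact: ler_norm.
Qed.

(* The coefficient of order [m] is recovered, up to the tail of order [N], as the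
   average over the [N]-th roots of unity of [Re (exp (- i m t) (F + i G) t)]. *)
Lemma cauchy_estimate_re (F G : R -> R) (al be : nat -> R) (M B : R) :
  0 <= B ->
  (forall t, (fun L : nat => \sum_(0 <= l < L)
     (cos (l%:R * t) * al l - sin (l%:R * t) * be l)) @ \oo --> F t) ->
  (forall t, (fun L : nat => \sum_(0 <= l < L)
     (cos (l%:R * t) * be l + sin (l%:R * t) * al l)) @ \oo --> G t) ->
  (forall t, `|F t| <= M) -> (forall t, `|G t| <= M) ->
  (forall l, `|al l| <= B * 2^-1 ^+ l) -> (forall l, `|be l| <= B * 2^-1 ^+ l) ->
  forall m, `|al m| <= 2 * M.
Proof.
move=> B0 HF HG FM GM aB bB m.
have cos1 (t : R) : `|cos t| <= 1 by rewrite ler_norml cos_geN1 cos_le1.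
have sin1 (t : R) : `|sin t| <= 1 by rewrite ler_norml sin_geN1 sin_le1.
have mul1 (x y z : R) : `|x| <= 1 -> `|y| <= z -> `|x * y| <= z.
  by move=> x1 yz; rewrite normrM -[leRHS]mul1r; apply: ler_pM.
pose S N t := \sum_(0 <= l < N) (cos (l%:R * t) * al l - sin (l%:R * t) * be l).
pose T N t := \sum_(0 <= l < N) (cos (l%:R * t) * be l + sin (l%:R * t) * al l).
have B20 : 0 <= 2 * B by rewrite mulr_ge0.
(* Each summand is at most [2 * B * 2^-1 ^+ l], and the geometric tail doubles this constant. *)
have SM N t : `|S N t| <= M + 4 * B * 2^-1 ^+ N.
  have := series_tail_le _ _ _ N B20 (HF t).
  rewrite -/(S N t) mulrA -natrM /= => H.
  have -> : S N t = F t - (F t - S N t) by rewrite opprB addrC subrK.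
  apply: (le_trans (ler_normB _ _)); apply: lerD => //; apply: H => l.
  apply: (le_trans (ler_normB _ _)).
  have -> : 2 * B * 2^-1 ^+ l = B * 2^-1 ^+ l + B * 2^-1 ^+ l by ring.
  by apply: lerD; apply: mul1.
have TM N t : `|T N t| <= M + 4 * B * 2^-1 ^+ N.
  have := series_tail_le _ _ _ N B20 (HG t).
  rewrite -/(T N t) mulrA -natrM /= => H.
  have -> : T N t = G t - (G t - T N t) by rewrite opprB addrC subrK.
  apply: (le_trans (ler_normB _ _)); apply: lerD => //; apply: H => l.
  apply: (le_trans (ler_normD _ _)).
  have -> : 2 * B * 2^-1 ^+ l = B * 2^-1 ^+ l + B * 2^-1 ^+ l by ring.
  by apply: lerD; apply: mul1.
have B80 : 0 <= 8 * B by rewrite mulr_ge0.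
apply: (eps_half_pow_le _ _ (8 * B) m B80) => N mN.
have N0 : 0 < N%:R :> R by rewrite ltr0n (leq_trans _ mN).
rewrite -(ler_pM2l N0) -[N%:R in leLHS](ger0_norm (ltW N0)) -normrM.
pose th k : R := k%:R * (pi *+ 2 / N%:R).
(* After exchanging the sums, [al l] is multiplied by the sum of the cosines of (m - l) [th k] and
   [be l] by that of the sines; orthogonality keeps only l = m. *)
have -> : N%:R * al m = \sum_(0 <= k < N)
    (cos (m%:R * th k) * S N (th k) + sin (m%:R * th k) * T N (th k)).
  under eq_bigr do rewrite /S /T !mulr_sumr -big_split.
  rewrite exchange_big /=.
  transitivity (\sum_(0 <= l < N) (if m == l then N%:R * al l else 0)).
    rewrite (bigD1_seq m) ?mem_index_iota ?iota_uniq //= eqxx big1 ?addr0 //.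
    by move=> l; rewrite eq_sym => /negPf ->.
  rewrite big_seq [RHS]big_seq; apply: eq_bigr => l; rewrite mem_index_iota /= => lN.
  have [Oc Os] := trig_orthogonality N m l mN lN.
  transitivity (al l *
        (\sum_(0 <= k < N) cos (k%:R * ((m%:R - l%:R) * (pi *+ 2 / N%:R)))) +
      be l * (\sum_(0 <= k < N) sin (k%:R * ((m%:R - l%:R) * (pi *+ 2 / N%:R))))).
    by rewrite Oc Os mulr0 addr0; case: eqP => _; rewrite ?mulr0 // mulrC.
  rewrite !mulr_sumr -big_split; apply: eq_bigr => k _ /=.
  have -> : k%:R * ((m%:R - l%:R) * (pi *+ 2 / N%:R)) = m%:R * th k - l%:R * th k.
    by rewrite /th; ring.
  rewrite cosB sinB; ring.
apply: (le_trans (ler_norm_sum _ _ _)).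
apply: (@le_trans _ _ (\sum_(0 <= k < N) (2 * M + 8 * B * 2^-1 ^+ N))); last first.
  by rewrite sumr_const_nat subn0 -[leLHS]mulr_natl.
apply: ler_sum => k _; apply: (le_trans (ler_normD _ _)).
have -> : 2 * M + 8 * B * 2^-1 ^+ N =
    (M + 4 * B * 2^-1 ^+ N) + (M + 4 * B * 2^-1 ^+ N) by ring.
by apply: lerD; apply: mul1.
Qed.
End TrigonometricCauchy.

Local Open Scope classical_set_scope.
Local Open Scope ring_scope.

(** * Proximate orders *)

(** The derivative of [rho * ln] at x is (rho x + rho'(x) x ln x) / x, whose numerator tends to
    [rho0]. *)
Lemma proximate_log_increment (R : realType) (rho : R -> R) (rho0 d : R) :
  proximate_order rho rho0 -> 0 < d ->
  exists2 T, 1 <= T & forall t r, T <= t -> t <= r ->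
    (rho0 - d) * (ln r - ln t) <= rho r * ln r - rho t * ln t
      <= (rho0 + d) * (ln r - ln t).
Proof.
move=> [_ [drho [_ [_ [rho_lim drho_lim]]]]] d0.
have d20 : 0 < d / 2 by rewrite divr_gt0.
have [M1 [_ HM1]] := (cvgrPdist_lt _ _).1 rho_lim _ d20.
have [M2 [_ HM2]] := (cvgrPdist_lt _ _).1 drho_lim _ d20.
exists (Num.max 1 (Num.max (M1 + 1) (M2 + 1))); first by rewrite le_max lexx.
move=> t r; rewrite !ge_max => /and3P[t1 tM1 tM2].
rewrite le_eqVlt => /predU1P[->|tr]; first by rewrite !subrr !mulr0 lexx.
(* Subtracting [c * ln] first lets a single mean value point compare both increments; for c =
   [rho0 - d] or [rho0 + d] the derivative there has a known sign. *)
have increment c : exists2 x, t < x &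
    rho r * ln r - rho t * ln t - c * (ln r - ln t) =
    ((rho x + derive1 rho x * x * ln x) - c) / x * (r - t).
  pose g : R -> R := rho * @ln R - c *: @ln R.
  have dg x : t <= x ->
      is_derive x 1 g ((rho x + derive1 rho x * x * ln x - c) / x).
    move=> tx; have x0 : 0 < x by lra.
    have dr := @derivableP _ _ _ _ _ _ (drho x x0).
    have dl := is_derive1_ln x0.
    have := is_deriveB (is_deriveM dr dl) (is_deriveZ c dl).
    rewrite -derive1E => H; apply: (is_derive_eq H); rewrite /GRing.scale /=.
    by field; lra.
  have [||x] := @MVT R g (fun x => (rho x + derive1 rho x * x * ln x - c) / x) t r tr.
  - by move=> x; rewrite in_itv /= => /andP[/ltW tx _]; exact: dg.
  - apply: derivable_within_continuous => x; rewrite in_itv /= => /andP[tx _].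
    by have [] := dg x tx.
  rewrite in_itv /= => /andP[tx _] E; exists x => //.
  by rewrite -E /g !fctE /GRing.scale /=; ring.
have near_rho0 x : t < x -> `|rho x + derive1 rho x * x * ln x - rho0| <= d.
  move=> tx.
  have /HM1 H1 : M1 < x by lra.
  have /HM2 H2 : M2 < x by lra.
  move: H1 H2; rewrite sub0r normrN distrC => H1 H2.
  by rewrite addrAC; apply: (le_trans (ler_normD _ _)); lra.
have rt : 0 < r - t by lra.
apply/andP; split.
  have [x tx E] := increment (rho0 - d).
  rewrite -subr_ge0 E; apply: mulr_ge0; last exact: ltW.
  have := near_rho0 x tx; rewrite ler_norml => /andP[h1 h2].
  by apply: divr_ge0; lra.
have [x tx E] := increment (rho0 + d).
rewrite -subr_le0 E; apply: mulr_le0_ge0; last exact: ltW.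
have := near_rho0 x tx; rewrite ler_norml => /andP[h1 h2].
by apply: mulr_le0_ge0; rewrite ?invr_ge0; lra.
Qed.

(** * The inverse of the growth function *)

Section InverseGrowth.
Variables (R : realType) (rho : R -> R) (rho0 : R) (phi : R -> R).
Hypotheses (rhoP : proximate_order rho rho0) (rhoN : normalized rho).
Hypothesis phiP : forall t : R, 0 < t -> 0 < phi t /\ phi t `^ rho (phi t) = t.

Lemma proximate_order_gt0 : 0 < rho0.
Proof. by case: rhoP => _ [_ [_ []]]. Qed.

Lemma growth_gt0 (r : R) : 0 < r -> 0 < r `^ rho r.
Proof. exact: powR_gt0. Qed.

Lemma growth_ltE (r s : R) : 0 < r -> 0 < s ->
  (r `^ rho r < s `^ rho s) = (r < s).
Proof. by move=> r0 s0; apply: rhoN.1; rewrite in_itv /= andbT. Qed.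

Lemma growth_leE (r s : R) : 0 < r -> 0 < s ->
  (r `^ rho r <= s `^ rho s) = (r <= s).
Proof. by move=> r0 s0; rewrite !leNgt growth_ltE. Qed.

(** [phiP] gives a right inverse; strict monotonicity makes it a left inverse too. *)
Lemma growthK (r : R) : 0 < r -> phi (r `^ rho r) = r.
Proof.
move=> r0; have [p0 pE] := phiP _ (growth_gt0 _ r0).
by apply: le_anti; rewrite -(growth_leE (phi _)) // -(growth_leE r) // pE lexx.
Qed.

Lemma ln_growth (t : R) : 0 < t -> ln t = rho (phi t) * ln (phi t).
Proof. by move=> t0; rewrite -{1}(phiP _ t0).2 ln_powR. Qed.

Lemma phi_ge (T t : R) : 0 < T -> T `^ rho T <= t -> T <= phi t.
Proof.
move=> T0 Tt; have t0 : 0 < t by apply: lt_le_trans Tt; exact: growth_gt0.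
by have [p0 pE] := phiP _ t0; rewrite -growth_leE // pE.
Qed.

(** Since ln t = rho(phi t) ln(phi t), the previous increments bound the slope of ln t against
    ln(phi t) near [rho0]; [p] is its reciprocal. *)
Lemma ln_phi_slope (d : R) : 0 < d ->
  exists2 T : R, 0 < T & forall s l, T <= s -> T <= l ->
    exists2 p, `|p - rho0^-1| < d &
      ln (phi s) - ln (phi l) = p * (ln s - ln l).
Proof.
move=> d0; have r0 := proximate_order_gt0.
have r0n : rho0 != 0 by rewrite gt_eqF.
have [e /= e0 He] := (cvgrPdist_lt _ _).1 (inv_continuous r0n) _ d0.
(* The first bound keeps the slope strictly inside the continuity ball, the second keeps it
   positive. *)
pose d' := Num.min (e / 2) (rho0 / 2).
have d'0 : 0 < d' by rewrite lt_min !divr_gt0.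
have [d'e d'r] : d' <= e / 2 /\ d' <= rho0 / 2 by rewrite !ge_min !lexx orbT.
have [T T1 HT] := proximate_log_increment _ _ _ _ rhoP d'0.
have T0 : 0 < T by lra.
exists (T `^ rho T); first exact: growth_gt0.
move=> s l; wlog ls : s l / l <= s => [W Ts Tl|].
  have [ls|sl] := leP l s; first exact: W.
  by have [p pd E] := W _ _ (ltW sl) Tl Ts; exists p => //; lra.
move=> Ts Tl.
have l0 : 0 < l by apply: lt_le_trans Tl; exact: growth_gt0.
have s0 : 0 < s by lra.
have [pl0 plE] := phiP _ l0; have [ps0 psE] := phiP _ s0.
have pp : phi l <= phi s by rewrite -growth_leE // plE psE.
have := HT _ _ (phi_ge _ _ T0 Tl) pp.
rewrite -(ln_growth _ l0) -(ln_growth _ s0).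
(* If one increment vanishes so does the other, and any slope serves. *)
have [->|X0] := eqVneq (ln (phi s) - ln (phi l)) 0.
  rewrite !mulr0 -eq_le => /eqP <-.
  by exists rho0^-1; rewrite ?subrr ?normr0 ?mulr0.
have Xge0 : 0 < ln (phi s) - ln (phi l).
  by rewrite lt_def X0 subr_ge0 ler_ln.
rewrite -(ler_pdivlMr _ _ Xge0) -(ler_pdivrMr _ _ Xge0).
set q := (ln s - ln l) / (ln (phi s) - ln (phi l)) => /andP[q1 q2].
have q0 : 0 < q by lra.
exists q^-1.
  rewrite distrC; apply: He; rewrite /= ltr_norml; apply/andP; split; lra.
rewrite -[ln s - ln l](divfK X0) -/q; field.
by rewrite gt_eqF.
Qed.
End InverseGrowth.

Lemma powR_expR_ln (R : realType) (x y : R) : 0 < x -> x `^ y = expR (y * ln x).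
Proof. by move=> x0; rewrite /powR gt_eqF. Qed.

Lemma geometric_sum_le (R : realType) (q : R) (N : nat) : 0 <= q -> q < 1 ->
  \sum_(0 <= l < N) q ^+ l <= (1 - q)^-1.
Proof.
move=> q0 q1; have q1' : 0 < 1 - q by lra.
rewrite -[leRHS]mul1r ler_pdivlMr // mulrC big_mkord.
by rewrite -opprB mulNr -subrX1 opprB gerBl exprn_ge0.
Qed.

(** * Growth of power sums against decay of coefficients *)

Section CoefficientGrowth.
Variables (R : realType) (rho : R -> R) (rho0 : R) (phi : R -> R).
Hypotheses (rhoP : proximate_order rho rho0) (rhoN : normalized rho).
Hypothesis phiP : forall t : R, 0 < t -> 0 < phi t /\ phi t `^ rho (phi t) = t.

Let r0 : 0 < rho0 := proximate_order_gt0 _ _ _ rhoP.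

Lemma ln_e_rho (s : R) : 0 < s ->
  ln (expR 1 * rho0 * s) = 1 + ln rho0 + ln s.
Proof. by move=> s0; rewrite !lnM ?expRK // posrE ?mulr_gt0 ?expR_gt0. Qed.

Lemma root_le_exp (c K t : R) (l : nat) : (0 < l)%N -> 0 < c -> 0 < t ->
  (c `^ l%:R^-1 * t <= expR K) = (ln c <= l%:R * (K - ln t)).
Proof.
move=> l0 c0 t0; rewrite powR_expR_ln // -{1}(lnK t0) -expRD ler_expR.
by rewrite -lerBrDr mulrC ler_pdivrMr ?ltr0n // mulrC.
Qed.

(** Read with s = r^rho(r), this bounds the logarithm of the l-th term. Writing the increment as p
    (ln s - ln l), the maximum over s of l p (ln s - ln l) - [s2 * s] is -l h(p). As h(1/rho0)
    exceeds [m] by twice [eta], one [eta] pays for replacing 1/rho0 by p and the other leaves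
    geometric decay. *)
Lemma ln_phi_tradeoff (s1 s2 : R) : 0 < s1 -> s1 < s2 ->
  exists T eta : R, [/\ 0 < T, 0 < eta & forall s l, T <= s -> T <= l ->
    l * (ln (phi s) - ln (phi l) + rho0^-1 * ln (expR 1 * rho0 * s1))
      <= s2 * s - eta * l].
Proof.
move=> s10 s12; have s20 : 0 < s2 by lra.
pose h (p : R) := p * (1 + ln s2 - ln p).
pose m := rho0^-1 * ln (expR 1 * rho0 * s1).
pose eta := (ln s2 - ln s1) / rho0 / 2.
have eta0 : 0 < eta by rewrite !divr_gt0 // subr_gt0 ltr_ln.
have ri0 : 0 < rho0^-1 by rewrite invr_gt0.
have hE : h rho0^-1 = m + eta + eta.
  by rewrite /h /m /eta ln_e_rho // lnV //; field; rewrite gt_eqF.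
have hc : h x @[x --> rho0^-1] --> h rho0^-1.
  apply: cvgM; first exact: cvg_id.
  apply: cvgB; first exact: cvg_cst.
  exact: continuous_ln.
have [e /= e0 He] := (cvgrPdist_lt _ _).1 hc _ eta0.
have d0 : 0 < Num.min e rho0^-1 by rewrite lt_min e0.
have [T T0 HT] := ln_phi_slope _ _ _ _ rhoP rhoN phiP _ d0.
exists T, eta; split=> // s l Ts Tl.
have [p pd ->] := HT _ _ Ts Tl.
move: pd; rewrite lt_min => /andP[pe pr].
have p0 : 0 < p by move: pr; rewrite ltr_norml; lra.
have hp : m + eta < h p.
  have /He : ball rho0^-1 e p by rewrite /ball /= distrC.
  by rewrite hE ltr_norml; lra.
have [l0 s0] : 0 < l /\ 0 < s by split; lra.
have pl0 : 0 < p * l by rewrite mulr_gt0.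
(* ln y <= y - 1, with equality at the maximiser s = p l / [s2]. *)
have : ln (s2 * s / (p * l)) <= s2 * s / (p * l) - 1.
  have := @le_ln1Dx R (s2 * s / (p * l) - 1).
  rewrite addrCA subrr addr0; apply; rewrite ltrBrDl subrr.
  by rewrite divr_gt0 // mulr_gt0.
rewrite lerBrDr ler_pdivlMr //.
rewrite -/m ln_div ?posrE ?mulr_gt0 // !lnM // => H.
have H2 : l * (m + eta) <= l * h p by rewrite ler_pM2l // ltW.
apply: (@le_trans _ _ (l * (p * (ln s - ln l)) + l * h p - eta * l)); first by lra.
rewrite lerD2r; apply: le_trans H.
by rewrite le_eqVlt; apply/orP; left; apply/eqP; rewrite /h; ring.
Qed.

(** For large r, late terms decay geometrically by the tradeoff, and the finitely many early ones
    are dominated through the power of order [l0]. *)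
Lemma power_sum_growth (c : nat -> R) (s1 s2 : R) :
  (forall l, 0 <= c l) -> 0 < s1 -> s1 < s2 ->
  (\forall l \near \oo, c l `^ l%:R^-1 * phi l%:R
     <= (expR 1 * rho0 * s1) `^ rho0^-1) ->
  exists M : R, forall (N : nat) (r : R), 0 <= r ->
    \sum_(0 <= l < N) c l * r ^+ l <= M * expR (s2 * r `^ rho r).
Proof.
move=> c_ge0 s10 s12 [l1 _ Hl1].
have s20 : 0 < s2 by lra.
have [T [eta [T0 eta0 HT]]] := ln_phi_tradeoff _ _ s10 s12.
pose K := rho0^-1 * ln (expR 1 * rho0 * s1).
have es0 : 0 < expR 1 * rho0 * s1 by rewrite !mulr_gt0 // expR_gt0.
(* The 1 excludes the meaningless root of order zero. *)
pose l0 := maxn (maxn l1 1) (Num.bound T).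
have [l01 l0p Tl0] : [/\ (l1 <= l0)%N, (0 < l0)%N & T <= l0%:R].
  split; rewrite ?leq_max ?leqnn ?orbT //.
  apply: (le_trans (ltW (archi_boundP (ltW T0)))).
  by rewrite ler_nat leq_max leqnn orbT.
pose R0 := Num.max 1 (phi T).
have R01 : 1 <= R0 by rewrite le_max lexx.
pose q := expR (- eta).
have q0 : 0 < q := expR_gt0 _.
have q1 : q < 1 by rewrite expR_lt1 oppr_lt0.
pose E r := expR (s2 * r `^ rho r).
have E1 r : 1 <= E r.
  by rewrite -(expR0 R) ler_expR mulr_ge0 ?powR_ge0 // ltW.
have key l r : (l0 <= l)%N -> R0 <= r ->
    expR (l%:R * (K - ln (phi l%:R))) * r ^+ l <= E r * q ^+ l.
  move=> ll R0r; have rp : 0 < r by lra.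
  have phiTr : phi T <= r by apply: le_trans R0r; rewrite le_max lexx orbT.
  have TV : T <= r `^ rho r.
    have [pT0 pTE] := phiP _ T0.
    by rewrite -[leLHS]pTE (growth_leE _ _ rhoN).
  have Tl : T <= l%:R by apply: le_trans Tl0 _; rewrite ler_nat.
  have := HT _ _ TV Tl; rewrite (growthK _ _ _ rhoN phiP) // -/K => H.
  rewrite -{1}(lnK rp) /E /q -!expRM_natl -!expRD ler_expR; lra.
(* From [key] at index [l0], solved for [r ^+ l0]. *)
pose B := expR (- (l0%:R * (K - ln (phi l0%:R)))).
pose D := \sum_(0 <= l < l0) c l.
have D0 : 0 <= D by apply: sumr_ge0.
have B0 : 0 < B := expR_gt0 _.
(* The 1 serves indices from [l0] on; the quotient serves smaller ones, where [q ^+ l] is at least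
   [q ^+ l0]. *)
pose G := 1 + D * B / q ^+ l0.
have ql0 : 0 < q ^+ l0 by rewrite exprn_gt0.
have DB0 : 0 <= D * B by apply: mulr_ge0 D0 (ltW B0).
have G1 : 0 <= D * B / q ^+ l0 by apply: divr_ge0 DB0 (ltW ql0).
have Gge1 : 1 <= G by rewrite lerDl.
have term l r : R0 <= r -> c l * r ^+ l <= G * E r * q ^+ l.
  move=> R0r; have rp : 0 < r by lra.
  have r1 : 1 <= r by lra.
  have Ep : 0 < E r := expR_gt0 _.
  have qlp : 0 < q ^+ l by rewrite exprn_gt0.
  have [ll|ll] := leqP l0 l.
    apply: (@le_trans _ _ (E r * q ^+ l)); last first.
      by rewrite -mulrA ler_peMl // ltW // mulr_gt0.
    apply: le_trans (key l r ll R0r).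
    rewrite ler_wpM2r ?exprn_ge0 ?(ltW rp) //.
    have := c_ge0 l; rewrite le_eqVlt => /predU1P[<-|cp]; first exact: expR_ge0.
    rewrite -{1}(lnK cp) ler_expR.
    have lp : (0 < l)%N by apply: leq_trans ll.
    have pl : 0 < phi l%:R by apply: (phiP _ _).1; rewrite ltr0n.
    rewrite -root_le_exp //; apply: le_trans (Hl1 l _) _ => /=.
      exact: leq_trans ll.
    by rewrite powR_expR_ln.
  have cD : c l <= D.
    rewrite /D (bigD1_seq l) ?mem_index_iota ?iota_uniq //= lerDl.
    by apply: sumr_ge0.
  have rB : r ^+ l <= B * E r.
    apply: (@le_trans _ _ (r ^+ l0)); first by rewrite ler_weXn2l // ltnW.
    rewrite /B expRN mulrC ler_pdivlMr ?expR_gt0 // mulrC.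
    apply: le_trans (key l0 r (leqnn _) R0r) _.
    by rewrite ger_pMr // exprn_ile1 // ltW.
  apply: (@le_trans _ _ (D * (B * E r))).
    by apply: ler_pM => //; apply: exprn_ge0; exact: ltW.
  rewrite mulrA [leRHS]mulrAC ler_pM2r // /G.
  apply: (@le_trans _ _ (D * B / q ^+ l0 * q ^+ l)); last first.
    by rewrite ler_pM2r // lerDr.
  rewrite -mulrA ler_peMr // mulrC ler_pdivlMr // mul1r.
  by apply: ler_wiXn2l; [exact: ltW | exact: ltW | exact: ltnW].
have sum_large N r : R0 <= r ->
    \sum_(0 <= l < N) c l * r ^+ l <= G * E r * (1 - q)^-1.
  move=> R0r; apply: (@le_trans _ _ (\sum_(0 <= l < N) G * E r * q ^+ l)).
    by apply: ler_sum => l _; exact: term.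
  rewrite -mulr_sumr ler_wpM2l ?geometric_sum_le ?(ltW q0) //.
  by apply: mulr_ge0; [rewrite /G; lra|exact: expR_ge0].
have q1p : 0 < (1 - q)^-1 by rewrite invr_gt0; lra.
have Gp : 0 < G by rewrite /G; lra.
exists (G * E R0 * (1 - q)^-1) => N r rp.
have [R0r|rR0] := leP R0 r.
  apply: le_trans (sum_large N r R0r) _.
  rewrite -/(E r) mulrAC ler_pM2r ?expR_gt0 // ler_pM2r //.
  by rewrite ler_peMr // ltW.
(* Below [R0] the power sum is at most its value at [R0], and [E r] is at least 1; this includes r =
   0. *)
apply: (@le_trans _ _ (G * E R0 * (1 - q)^-1)); last first.
  rewrite -/(E r) ler_peMr //; apply/ltW.
  by rewrite !mulr_gt0 // expR_gt0.
apply: le_trans (sum_large N R0 (lexx _)).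
apply: ler_sum => l _; rewrite ler_wpM2l // lerXn2r ?nnegrE ?(ltW rR0) //; lra.
Qed.

(** To leading order [s1 * s] - l ln(phi s) is least at s = l / ([s1 * rho0]), so the hypothesis is
    used at r = phi s. Half of the gap between [s1] and [s2], namely [g], absorbs the constant, the
    other half the error in the slope. *)
Lemma coefficient_root_bound (c : nat -> R) (C r1 s1 s2 : R) :
  (forall l, 0 <= c l) -> 0 < s1 -> s1 < s2 ->
  (forall l r, r1 <= r -> 0 < r -> c l * r ^+ l <= C * expR (s1 * r `^ rho r)) ->
  \forall l \near \oo,
    c l `^ l%:R^-1 * phi l%:R <= (expR 1 * rho0 * s2) `^ rho0^-1.
Proof.
move=> c_ge0 s10 s12 Hc.
have s20 : 0 < s2 by lra.
pose C1 := Num.max 1 C.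
have C11 : 1 <= C1 by rewrite le_max lexx.
pose g := (ln s2 - ln s1) / rho0 / 2.
have g0 : 0 < g by rewrite !divr_gt0 // subr_gt0 ltr_ln.
pose w := ln (s1 * rho0).
have sr0 : 0 < s1 * rho0 by rewrite mulr_gt0.
(* Makes the slope error times |w| at most [g]; the 1 guards against w = 0. *)
have d0 : 0 < g / (`|w| + 1) by rewrite divr_gt0 // ltr_wpDl.
have [T T0 HT] := ln_phi_slope _ _ _ _ rhoP rhoN phiP _ d0.
pose T1 := Num.max r1 1.
have T10 : 0 < T1 by rewrite lt_max ltr01 orbT.
have es0 : 0 < expR 1 * rho0 * s2 by rewrite !mulr_gt0 // expR_gt0.
near=> l.
have l1 : 1 <= l%:R :> R by near: l; exact: nbhs_infty_ger.
have lT : T <= l%:R by near: l; exact: nbhs_infty_ger.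
have lT' : T * (s1 * rho0) <= l%:R by near: l; exact: nbhs_infty_ger.
have lV : T1 `^ rho T1 * (s1 * rho0) <= l%:R by near: l; exact: nbhs_infty_ger.
have lC : ln C1 / g <= l%:R by near: l; exact: nbhs_infty_ger.
have lp : (0 < l)%N by rewrite -(ltr0n R); lra.
have lp' : 0 < l%:R :> R by rewrite ltr0n.
have [pl0 _] := phiP _ lp'.
(* A zero coefficient has no logarithm; its root is 0 because the exponent is nonzero. *)
have := c_ge0 l; rewrite le_eqVlt => /predU1P[<-|cp].
  by rewrite powR0 ?mul0r ?powR_ge0 // invr_eq0 gt_eqF.
rewrite (powR_expR_ln _ _ _ es0) root_le_exp //.
pose s := l%:R / (s1 * rho0).
have sp : 0 < s by rewrite divr_gt0.
have Ts : T <= s by rewrite ler_pdivlMr.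
have [ps0 psE] := phiP _ sp.
have T1s : T1 <= phi s by apply: (phi_ge _ _ _ rhoN phiP) => //; rewrite ler_pdivlMr.
have r1s : r1 <= phi s by apply: le_trans T1s; rewrite le_max lexx.
have H : c l * phi s ^+ l <= C1 * expR (s1 * s).
  apply: le_trans (Hc l _ r1s ps0) _.
  by rewrite psE ler_wpM2r ?expR_ge0 // le_max lexx orbT.
have H' : ln (c l) + l%:R * ln (phi s) <= ln C1 + l%:R / rho0.
  have C1p : 0 < C1 by lra.
  move: H; rewrite -{1}(lnK cp) -{1}(lnK ps0) -{1}(lnK C1p) -expRM_natl -!expRD ler_expR.
  move=> /le_trans; apply; rewrite lerD2l le_eqVlt; apply/orP; left.
  by apply/eqP; rewrite /s; field; rewrite !gt_eqF.
have [p pd pE] := HT _ _ lT Ts.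
have lnls : ln l%:R - ln s = w.
  by rewrite /s ln_div // opprB addrC subrK.
rewrite lnls in pE.
have pw : p * w <= rho0^-1 * w + g.
  rewrite -lerBlDl -mulrBl; apply: le_trans (ler_norm _) _.
  rewrite normrM; apply: (@le_trans _ _ (g / (`|w| + 1) * (`|w| + 1))).
    by apply: ler_pM => //; [exact: ltW | rewrite lerDl].
  by rewrite divfK // gt_eqF // ltr_wpDl.
have lgC : ln C1 <= l%:R * g by rewrite -ler_pdivrMr.
rewrite ln_e_rho //.
have wE : w = ln s1 + ln rho0 by rewrite /w lnM.
have gE : g *+ 2 = rho0^-1 * (ln s2 - ln s1) by rewrite /g; field; rewrite gt_eqF.
have pE' : ln (phi l%:R) - ln (phi s) + g <= rho0^-1 * (ln rho0 + ln s2).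
  by rewrite pE; rewrite wE mulr2n in pw gE *; lra.
have : l%:R * (ln (phi l%:R) - ln (phi s) + g) <= l%:R * (rho0^-1 * (ln rho0 + ln s2)).
  by rewrite ler_pM2l.
lra.
Unshelve. all: by end_near.
Qed.
End CoefficientGrowth.

(** * Growth of slice monogenic functions *)

Lemma limf_esup_leP (R : realType) (T : choiceType) (X : filteredType T)
    (g : X -> \bar R) (F : set_system X) (FF : Filter F) (c : R) :
  (limf_esup g F <= c%:E)%E <->
  (forall e : R, 0 < e -> \forall x \near F, (g x <= (c + e)%:E)%E).
Proof.
rewrite limf_esupE; split=> [H e e0|H].
  have : (ereal_inf [set ereal_sup [set g x | x in V] | V in F] < (c + e)%:E)%E.
    by apply: (le_lt_trans H); rewrite lte_fin ltrDl.
  move=> /ereal_inf_lt [_ [V FV <-] sV].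
  apply: filterS FV => x Vx; apply: le_trans (ltW sV).
  by apply: ereal_sup_ubound; exists x.
apply/lee_addgt0Pr => e e0; have FV := H e e0.
apply: ge_ereal_inf; eexists; first by exists [set x | (g x <= (c + e)%:E)%E].
by rewrite -EFinD; apply: ge_ereal_sup => _ [x gx <-].
Qed.

Lemma eq_series_cvg (R : realType) (u v : nat -> R) (s : R) : u =1 v ->
  (fun N : nat => \sum_(0 <= l < N) u l) @ \oo --> s ->
  (fun N : nat => \sum_(0 <= l < N) v l) @ \oo --> s.
Proof. by move=> /funext ->. Qed.

(** * Power series on the slice and Cauchy's estimate *)

Section SeriesOnSlice.
Variables (R : realType) (n : nat) (hn : (0 < n)%N).
Variables (f : Para R n -> Cl R n) (a : nat -> Cl R n).
Hypothesis fa : has_series f a.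

Lemma slice_coord_le_series (u v B : R) A :
  (forall N, \sum_(0 <= l < N) clnorm (a l) * pnorm (slice R n hn u v) ^+ l <= B) ->
  `|f (slice R n hn u v) A| <= 2 * B.
Proof.
move=> HB; apply: (norm_cvg_le _ _ _ _ (fa _ A)); near=> N.
apply: (le_trans (ler_norm_sum _ _ _)).
apply: (@le_trans _ _ (\sum_(0 <= l < N)
    2 * (clnorm (a l) * pnorm (slice R n hn u v) ^+ l))).
  by apply: ler_sum => l _; exact: coord_clpow_slice_le.
by rewrite -mulr_sumr ler_wpM2l.
Unshelve. all: by end_near.
Qed.

(** At a real point, written with angle 0, the series becomes an ordinary power series; each term is
    a difference of two bounded partial sums. *)
Lemma coord_power_bounded (t : R) (A : {set 'I_n}) :
  exists2 B : R, 0 <= B & forall l, `|a l A| * `|t| ^+ l <= B.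
Proof.
have H := fa (slice R n hn (t * cos 0) (t * sin 0)) A.
have E l : clmul (clpow (pv (slice R n hn (t * cos 0) (t * sin 0))) l) (a l) A
    = t ^+ l * a l A.
  by rewrite pv_slice clpow_polar clmul_planar mulr0 sin0 cos0 mulr1 mulr0 mul0r addr0.
have {}H := eq_series_cvg _ _ _ _ E H.
have [B [_ HB]] := cvg_seq_bounded (cvgP _ H).
have {}HB N : `|\sum_(0 <= l < N) t ^+ l * a l A| <= B + 1 by apply: HB; rewrite ?ltrDl.
exists (B + 1 + (B + 1)) => [|l].
  by apply: addr_ge0; apply: le_trans (HB 0%N).
have -> : `|a l A| * `|t| ^+ l = `|\sum_(0 <= k < l.+1) t ^+ k * a k A
     - \sum_(0 <= k < l) t ^+ k * a k A|.
  by rewrite big_nat_recr //= addrAC subrr add0r normrM normrX mulrC.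
by apply: (le_trans (ler_normB _ _)); apply: lerD.
Qed.

(** On the circle of radius r, the coordinates [A] and [flip A] are, up to sign, the real and
    imaginary parts of a complex power series. *)
Lemma cauchy_estimate (r M : R) : 0 < r ->
  (forall x, pnorm x <= r -> clnorm (f x) <= M) ->
  forall m, clnorm (a m) * r ^+ m <= #|{set 'I_n}|%:R * (2 * M).
Proof.
move=> r0 fM m.
have rm0 : 0 < r ^+ m by rewrite exprn_gt0.
have M0 : 0 <= M.
  have p0 : pnorm (slice R n hn 0 0) <= r.
    have := pnorm_slice_sqr R n hn 0 0.
    by rewrite expr0n addr0 => /eqP; rewrite sqrf_eq0 => /eqP ->; exact: ltW.
  by apply: le_trans (fM _ p0); exact: sqrtr_ge0.
rewrite -ler_pdivlMr // -mulrA; apply: clnorm_le => [|A].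
  by rewrite divr_ge0 ?mulr_ge0 // ltW.
rewrite ler_pdivlMr // -[r ^+ m]ger0_norm ?(ltW rm0) // -normrM mulrC.
pose e : R := (-1) ^+ (Ordinal hn \notin A).
have ee : e * e = 1 by rewrite /e; case: (_ \notin _); ring.
have e1 : `|e| = 1 by rewrite /e normrX normrN1 expr1n.
have e' : (-1) ^+ (Ordinal hn \notin flip n hn A) = - e :> R.
  by rewrite /e mem_flip; case: (_ \notin _) => /=; ring.
pose z t := slice R n hn (r * cos t) (r * sin t).
have zr t : pnorm (z t) <= r.
  rewrite -(ler_pXn2r (n := 2)) ?nnegrE ?pnorm_ge0 ?(ltW r0) //.
  rewrite pnorm_slice_sqr !exprMn -mulrDr cos2Dsin2 mulr1 //.
have fz t C : `|f (z t) C| <= M.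
  by apply: (le_trans (coord_le_clnorm _ _ (f (z t)) C)); exact: fM.
have [B B0 HB] := coord_power_bounded (2 * r) A.
have [B' B'0 HB'] := coord_power_bounded (2 * r) (flip n hn A).
(* Boundedness at radius 2r yields the factor 2^-l at radius r. *)
have half (l : nat) (y D : R) : `|y| * `|2 * r| ^+ l <= D -> `|r ^+ l * y| <= D * 2^-1 ^+ l.
  move=> H; rewrite normrM exprVn ler_pdivlMr ?exprn_gt0 //; apply: le_trans H.
  rewrite [`|2 * r|]normrM normr_nat exprMn normrX le_eqVlt; apply/orP; left.
  by apply/eqP; ring.
(* The sign -e orients the imaginary part so that both series take the required form; e e = 1
   restores it. *)
apply: (cauchy_estimate_re R (fun t => f (z t) A)
  (fun t => - e * f (z t) (flip n hn A))
  (fun l => r ^+ l * a l A) (fun l => - e * (r ^+ l * a l (flip n hn A))) M (B + B')).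
- exact: addr_ge0.
- move=> t; have := fa (z t) A.
  apply: eq_series_cvg => l.
  by rewrite pv_slice clpow_polar clmul_planar -/e; ring.
- move=> t; have : (fun N => - e * \sum_(0 <= l < N)
      clmul (clpow (pv (z t)) l) (a l) (flip n hn A)) @ \oo
      --> - e * f (z t) (flip n hn A) by apply: cvgMl_tmp; exact: fa.
  under eq_fun do rewrite mulr_sumr.
  apply: eq_series_cvg => l.
  rewrite pv_slice clpow_polar clmul_planar e' flipK.
  rewrite [X in _ = _ + X](_ : _ = e * e * (sin (l%:R * t) * (r ^+ l * a l A))).
    by ring.
  by rewrite ee mul1r.
- by move=> t; exact: fz.
- by move=> t; rewrite normrM normrN e1 mul1r.
- move=> l; apply: le_trans (half _ _ _ (HB l)) _.
  by rewrite ler_wpM2r ?exprn_ge0 // lerDl.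
- move=> l; rewrite normrM normrN e1 mul1r; apply: le_trans (half _ _ _ (HB' l)) _.
  by rewrite ler_wpM2r ?exprn_ge0 // lerDr.
Unshelve. all: by end_near.
Qed.
End SeriesOnSlice.

(** * The implications between the four conditions *)

Section GrowthClasses.
Variables (R : realType) (n : nat) (hn : (0 < n)%N).
Variables (rho : R -> R) (rho0 : R) (phi : R -> R).
Variables (f : Para R n -> Cl R n) (a : nat -> Cl R n).
Hypotheses (rhoP : proximate_order rho rho0) (rhoN : normalized rho).
Hypothesis phiP : forall t : R, 0 < t -> 0 < phi t /\ phi t `^ rho (phi t) = t.
Hypotheses (fS : slice_monogenic f) (fa : has_series f a).

Let rho0_gt0 : 0 < rho0 := proximate_order_gt0 _ _ _ rhoP.

Lemma growth_ge (X r : R) : 0 < X -> phi X <= r -> X <= r `^ rho r.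
Proof.
move=> X0 Xr; have [p0 pE] := phiP _ X0.
by rewrite -[leLHS]pE (growth_leE _ _ rhoN) // (lt_le_trans p0).
Qed.

(* At [r = 0] the library sets [0 `^ 0 = 1], hence the hypothesis [1 <= s `^ rho s]. *)
Lemma growth_le0 (r s : R) : 0 <= r -> r <= s -> 1 <= s `^ rho s ->
  r `^ rho r <= s `^ rho s.
Proof.
rewrite le_eqVlt => /predU1P[<- _|r0 rs _].
  by apply: le_trans; rewrite /powR eqxx; case: (_ == 0).
by rewrite (growth_leE _ _ rhoN) // (lt_le_trans r0).
Qed.

(** Zeros of [f] are harmless: their logarithm is minus infinity and the exponential bound is
    positive. *)
Lemma logmax_le (r c : R) :
  (logmax f r <= c%:E)%E <->
  (forall x, pnorm x <= r -> clnorm (f x) <= expR c).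
Proof.
split=> [H x xr|H].
  have : (eln (clnorm (f x)) <= c%:E)%E.
    by apply: le_trans H; apply: ereal_sup_ubound; exists x.
  rewrite /eln; case: ifPn => [p|]; last first.
    by rewrite -leNgt => /le_trans h _; apply: h; exact: expR_ge0.
  by rewrite lee_fin -{2}(lnK p) ler_expR.
apply: ge_ereal_sup => _ [x xr <-]; rewrite /eln; case: ifPn => [p|_].
  by rewrite lee_fin -ler_expR lnK //; exact: H.
exact: leNye.
Qed.

Lemma A_class0_logmax (sigma : R) : 0 <= sigma -> A_class0 rho sigma f ->
  (limf_esup (fun r : R => (logmax f r * ((r `^ rho r)^-1)%R%:E)%E)
     (pinfty_nbhs R) <= sigma%:E)%E.
Proof.
move=> s0 fA; apply/limf_esup_leP => e e0.
have e20 : 0 < e / 2 by rewrite divr_gt0.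
have [_ [M HM]] := fA _ e20.
pose M1 := Num.max M 1.
have M11 : 1 <= M1 by rewrite le_max lexx orbT.
(* Beyond this value of the growth function, the second half of [e] absorbs the constant [M1]. *)
pose X := Num.max 1 (ln M1 / (e / 2)).
have X1 : 1 <= X by rewrite le_max lexx.
near=> r.
have rX : X <= r `^ rho r.
  by apply: growth_ge; [lra | near: r; apply: nbhs_pinfty_ge; exact: num_real].
have V1 : 1 <= r `^ rho r by lra.
have V0 : 0 < r `^ rho r by lra.
rewrite lee_pdivrMr // -EFinM; apply/logmax_le => x xr.
have := HM x; rewrite mulNr expRN ler_pdivrMr ?expR_gt0 // => /le_trans; apply.
have MM : M <= expR (ln M1) by rewrite lnK ?posrE; [rewrite le_max lexx | lra].
apply: (@le_trans _ _ (expR (ln M1) * expR ((sigma + e / 2) * r `^ rho r))).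
  apply: (@le_trans _ _ (expR (ln M1) * expR ((sigma + e / 2) * pnorm x `^ rho (pnorm x)))).
    by rewrite ler_wpM2r ?expR_ge0.
  rewrite ler_pM2l ?expR_gt0 // ler_expR ler_pM2l; last by lra.
  by apply: growth_le0 => //; exact: pnorm_ge0.
rewrite -expRD ler_expR.
have : ln M1 <= (e / 2) * r `^ rho r.
  by rewrite mulrC -ler_pdivrMr //; apply: le_trans rX; rewrite le_max lexx orbT.
lra.
Unshelve. all: by end_near.
Qed.

Lemma logmax_coefficients (sigma : R) : 0 <= sigma ->
  (limf_esup (fun r : R => (logmax f r * ((r `^ rho r)^-1)%R%:E)%E)
     (pinfty_nbhs R) <= sigma%:E)%E ->
  (limn_esup (fun l : nat => (clnorm (a l) `^ (l%:R^-1) * phi l%:R)%R%:E)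
    <= ((expR 1 * rho0 * sigma) `^ rho0^-1)%R%:E)%E.
Proof.
move=> s0 /limf_esup_leP Hlim; apply/limf_esup_leP => e e0.
have er0 : 0 < expR 1 * rho0 by rewrite mulr_gt0 ?expR_gt0.
pose L := (expR 1 * rho0 * sigma) `^ rho0^-1.
have L0 : 0 <= L := powR_ge0 _ _.
(* The type whose coefficient bound is exactly [L + e]. *)
pose s2 := (L + e) `^ rho0 / (expR 1 * rho0).
have s2E : (expR 1 * rho0 * s2) `^ rho0^-1 = L + e.
  rewrite /s2 mulrC divfK ?gt_eqF // -powRrM divff ?gt_eqF // powRr1 //; lra.
have ss2 : sigma < s2.
  rewrite /s2 ltr_pdivlMr // mulrC.
  have -> : expR 1 * rho0 * sigma = L `^ rho0.
    rewrite /L -powRrM mulVf ?gt_eqF // powRr1 // mulr_ge0 //; exact: ltW.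
  by apply: gt0_ltr_powR => //; rewrite ?nnegrE ?ltrDl //; lra.
(* The intermediate type [sigma + d] is positive even when sigma = 0. *)
pose d := (s2 - sigma) / 2.
have d0 : 0 < d by rewrite divr_gt0 // subr_gt0.
have [s1p s12] : 0 < sigma + d /\ sigma + d < s2 by rewrite /d; split; lra.
have [r1 [_ Hr1]] := Hlim _ d0.
have bound l r : r1 + 1 <= r -> 0 < r ->
    clnorm (a l) * r ^+ l <=
    (#|{set 'I_n}|%:R * 2) * expR ((sigma + d) * r `^ rho r).
  move=> rr r0; rewrite -mulrA; apply: (cauchy_estimate R n hn f a fa) => //.
  apply/logmax_le; rewrite EFinM -lee_pdivrMr ?growth_gt0 //.
  by apply: Hr1; lra.
have a0 l : 0 <= clnorm (a l) := sqrtr_ge0 _.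
have := coefficient_root_bound _ _ _ _ rhoP rhoN phiP _ _ _ _ _ a0 s1p s12 bound.
by apply: filterS => l; rewrite s2E lee_fin.
Qed.

Lemma coefficients_A_class (sigma eps : R) : 0 <= sigma -> 0 < eps ->
  (limn_esup (fun l : nat => (clnorm (a l) `^ (l%:R^-1) * phi l%:R)%R%:E)
    <= ((expR 1 * rho0 * sigma) `^ rho0^-1)%R%:E)%E ->
  A_class rho (sigma + eps) f.
Proof.
move=> s0 eps0 /limf_esup_leP Hlim; split=> //.
have er0 : 0 < expR 1 * rho0 by rewrite mulr_gt0 ?expR_gt0.
pose s1 := sigma + eps / 2.
have [s10 s12 ss1] : [/\ 0 < s1, s1 < sigma + eps & sigma < s1].
  by rewrite /s1; split; lra.
have gap : 0 < (expR 1 * rho0 * s1) `^ rho0^-1 - (expR 1 * rho0 * sigma) `^ rho0^-1.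
  rewrite subr_gt0; apply: gt0_ltr_powR; rewrite ?invr_gt0 ?nnegrE ?ltr_pM2l //.
  - by rewrite mulr_ge0 // ltW.
  - by rewrite mulr_ge0 // ltW.
have near_a : \forall l \near \oo, clnorm (a l) `^ l%:R^-1 * phi l%:R
     <= (expR 1 * rho0 * s1) `^ rho0^-1.
  by apply: filterS (Hlim _ gap) => l; rewrite lee_fin [_ + (_ - _)]addrC subrK.
have a0 l : 0 <= clnorm (a l) := sqrtr_ge0 _.
have [M HM] := power_sum_growth _ _ _ _ rhoP rhoN phiP _ _ _ a0 s10 s12 near_a.
pose K : R := #|{set 'I_n}|%:R.
(* The 2 comes from the slice, [1 + K] from leaving it, and [K] from passing from coordinates to the
   norm. *)
exists (K * ((1 + K) * (2 * M))) => x.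
rewrite mulNr expRN ler_pdivrMr ?expR_gt0 // -!mulrA.
set E := expR _.
have ME0 : 0 <= 2 * (M * E).
  by rewrite mulr_ge0 //; have := HM 0%N _ (pnorm_ge0 _ _ x); rewrite big_geq.
apply: clnorm_le => [|A]; first by rewrite mulr_ge0 // addr_ge0 // ler0n.
apply: (slice_monogenic_coord_le R n hn f (pnorm x) (2 * (M * E)) fS (pnorm_ge0 _ _ x)) => //.
move=> u v C uv; apply: (slice_coord_le_series R n hn f a fa) => N.
by rewrite uv; apply: HM; exact: pnorm_ge0.
Qed.

Lemma A_class_le (b b' : R) : b <= b' -> A_class rho b f -> A_class rho b' f.
Proof.
move=> bb [_ [M HM]]; split=> //; exists M => x; apply: le_trans (HM x).
rewrite ler_wpM2l ?sqrtr_ge0 // ler_expR ler_wpM2r ?powR_ge0 //; lra.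
Qed.
End GrowthClasses.

Theorem theorem3p7 (R : realType) (n : nat) (hn : (0 < n)%N)
    (rho : R -> R) (rho0 : R) (phi : R -> R) (sigma : R)
    (f : Para R n -> Cl R n) (a : nat -> Cl R n) :
  proximate_order rho rho0 -> normalized rho ->
  (forall t : R, 0 < t -> 0 < phi t /\ phi t `^ rho (phi t) = t) ->
  0 <= sigma ->
  slice_monogenic f -> has_series f a ->
  [<-> A_class0 rho sigma f;
       (limf_esup (fun r : R => (logmax f r * ((r `^ rho r)^-1)%R%:E)%E)
          (pinfty_nbhs R) <= sigma%:E)%E;
       (limn_esup (fun l : nat =>
            (clnorm (a l) `^ (l%:R^-1) * phi l%:R)%R%:E)
          <= ((expR 1 * rho0 * sigma) `^ rho0^-1)%R%:E)%E;
       (ereal_inf [set b%:E | b in [set b : R | (0 < b)%R /\ A_class rho b f]]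
          <= sigma%:E)%E].
Proof.
move=> rhoP rhoN phiP s0 fS fa.
tfae.
- exact: (A_class0_logmax R n rho phi f rhoN phiP).
- exact: (logmax_coefficients R n hn rho rho0 phi f a).
- move=> H; apply/lee_addgt0Pr => e e0; apply: ge_ereal_inf; exists (sigma + e)%:E => //.
  exists (sigma + e) => //; split; first by lra.
  exact: (coefficients_A_class R n hn rho rho0 phi f a).
(* The infimum lies below [sigma + eps], so some admissible b does too, and the classes increase
   with b. *)
- move=> H eps eps0.
  have : (ereal_inf [set b%:E | b in [set b : R | (0 < b)%R /\ A_class rho b f]]
      < (sigma + eps)%:E)%E by apply: le_lt_trans H _; rewrite lte_fin ltrDl.
  move=> /ereal_inf_lt [_ [b [b0 fb] <-]]; rewrite lte_fin => /ltW bs.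
  exact: (A_class_le R n rho f fS b).
Qed.
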